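(* Let $p$ be a prime, let $\zeta=e^{2\pi i/p}$, and let $(c_{ij})_{i,j\ge 1}$ be an arbitrary skew-symmetric matrix over the Galois field $\mathbb{Z}_p=\{0,1,\dots,p-1\}$. There is a Hilbert space $H\neq\{0\}$ and a sequence of unitary operators $U_1,U_2,\dots\in\mathcal B(H)$ such that $U_k^p=\mathbf 1$ and $U_jU_k=\zeta^{c_{jk}}U_kU_j$ for every $j,k=1,2,\dots$.
   Context: A matrix $(c_{ij})$ over $\mathbb{Z}_p$ is skew-symmetric if $c_{ij}=-c_{ji}$ and $c_{ii}=0$ for all $i,j$ (the latter is automatic for $p$ odd; for $p=2$ it means a symmetric matrix with zeros along the main diagonal). *)

(* Defs.v *)
From HB Require Import structures.
From mathcomp Require Import all_boot all_order all_algebra.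
From mathcomp Require Import all_classical all_reals all_analysis.
From mathcomp Require Import sesquilinear complex.

Set Implicit Arguments.
Unset Strict Implicit.
Unset Printing Implicit Defensive.

Import Order.TTheory GRing.Theory Num.Theory.
Import numFieldNormedType.Exports.

Local Open Scope ring_scope.
Local Open Scope complex_scope.

(* The inner product is linear in its first argument and conjugate-linear in
   its second one.  The norm of a normed module over R[i] takes its values in
   R[i], where 0 <= z entails that z is real. *)
HB.mixin Record CompleteNormedModule_isHilbert (R : realType) H
    of CompleteNormedModule R[i] H := {
  inner : {dot H for (@Num.conj R[i])};
  sqr_norm_inner : forall x : H, `|x| ^+ 2 = inner x x
}.

#[short(type="hilbertType")]
HB.structure Definition Hilbert (R : realType) :=
  {H of CompleteNormedModule R[i] H & CompleteNormedModule_isHilbert R H}.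

Section Operators.
Variables (R : realType) (H : hilbertType R).
Implicit Types U V : {linear H -> H}.

Definition bounded_operator U : Prop :=
  exists M : R, forall x : H, `|U x| <= M%:C * `|x|.

Definition is_adjoint U V : Prop :=
  forall x y : H, inner (U x) y = inner x (V y).

Definition unitary_operator U : Prop :=
  bounded_operator U /\
  exists V, [/\ bounded_operator V, is_adjoint U V, V \o U =1 id & U \o V =1 id].

End Operators.

Definition expC (R : realType) (z : R[i]) : R[i] :=
  let: x +i* y := z in (expR x)%:C * (cos y +i* sin y).

Definition zeta (R : realType) (p : nat) : R[i] :=
  expC ((2 * pi / p%:R) *i).

(* Infinite matrices are indexed by nat, so the indices start at 0 instead
   of 1. *)
Definition skew_symmetric_matrix (A : zmodType) (c : nat -> nat -> A) : Prop :=
  forall i j : nat, c i j = - c j i /\ c i i = 0.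

(* Main.v *)
From HB Require Import structures.
Require Import Defs.
From mathcomp Require Import all_boot all_order all_algebra.
From mathcomp Require Import all_classical all_reals all_analysis.
From mathcomp Require Import sesquilinear complex.
From mathcomp Require Import ring lra.

(* Take H = l^2(I) with I the set of all sequences v : nat -> F_p, and let
     (U_k x)(v) = zeta^(phase_k v) x(v + e_k),
     phase_k v = sum_(j < k) c_jk v_j.
   Since phase_k does not involve v_k, U_k^p shifts v by p e_k = 0 and multiplies
   by zeta^(p phase_k v) = 1.  Comparing U_j U_k with U_k U_j leaves the factor
   zeta^(phase_k e_j - phase_j e_k), and skew-symmetry turns this exponent into
   c_jk whichever of j and k is the larger.  The index set I is uncountable, so H
   is not separable; this is harmless and avoids restricting to finitely supported
   sequences. *)

Set Implicit Arguments.
Unset Strict Implicit.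
Unset Printing Implicit Defensive.

Import Order.TTheory GRing.Theory Num.Theory.
Import numFieldNormedType.Exports.

Local Open Scope classical_set_scope.
Local Open Scope ring_scope.
Local Open Scope complex_scope.

Local Notation Re := complex.Re.
Local Notation Im := complex.Im.
(* In ring_scope this notation would otherwise denote Num.conj, which is
   convertible to conjc on R[i] but not syntactically equal to it. *)
Local Notation "z ^*" := (conjc z) : ring_scope.

(** * Unordered sums of real families over an arbitrary index type *)

Section RealSum.
Variables (R : realType) (I : choiceType).
Implicit Types (f g : I -> R) (c : R).

(** [esum] is the supremum of the finite partial sums, so [I] may be uncountable and a divergent sum
    is [+oo]. *)
Definition nnsum f : \bar R := (\esum_(i in [set: I]) (f i)%:E)%E.

Definition abs_summable f : Prop := (nnsum (fun i => `|f i|%R) < +oo)%E.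

(* Both |f| and |f| - f are nonnegative.  Since fine +oo = 0, the value is
   meaningful only for absolutely summable f. *)
Definition rsum f : R :=
  fine (nnsum (fun i => `|f i|)) - fine (nnsum (fun i => `|f i| - f i)).

Lemma nnsum_ge0 f : (forall i, 0 <= f i) -> (0 <= nnsum f)%E.
Proof. by move=> f0; apply: esum_ge0 => i _; rewrite lee_fin. Qed.

Lemma le_nnsum f g : (forall i, f i <= g i) -> (nnsum f <= nnsum g)%E.
Proof. by move=> fg; apply: le_esum => i _; rewrite lee_fin. Qed.

Lemma nnsumD f g : (forall i, 0 <= f i) -> (forall i, 0 <= g i) ->
  nnsum (fun i => f i + g i) = (nnsum f + nnsum g)%E.
Proof.
move=> f0 g0; rewrite /nnsum -esumD; last 2 first.
- by move=> i _; rewrite lee_fin.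
- by move=> i _; rewrite lee_fin.
by apply: eq_esum => i _; rewrite EFinD.
Qed.

Lemma nnsum_fin_num f : (forall i, 0 <= f i) -> (nnsum f < +oo)%E ->
  nnsum f \is a fin_num.
Proof. by move=> f0 ffin; rewrite ge0_fin_numE// nnsum_ge0. Qed.

Lemma nnsumZ c f : 0 <= c -> (forall i, 0 <= f i) ->
  nnsum (fun i => c * f i) = (c%:E * nnsum f)%E.
Proof.
move=> + f0; rewrite le_eqVlt => /predU1P[<-|c0].
  (* The convention [0 * +oo = 0] covers divergent [f] here. *)
  by rewrite mul0e /nnsum esum1// => i _; rewrite mul0r.
have le d g : 0 < d -> (forall i, 0 <= g i) ->
    (nnsum (fun i => (d * g i)%R) <= d%:E * nnsum g)%E.
  move=> d0 g0; apply: ge_ereal_sup => _ [A [finA _] <-].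
  under eq_fsbigr do rewrite EFinM.
  rewrite -ge0_mule_fsumr; last by move=> i; rewrite lee_fin.
  rewrite lee_pmul2l// ?lte_fin//; apply: ereal_sup_ubound.
  by exists A.
apply/eqP; rewrite eq_le le//= muleC -lee_pdivlMr//.
(* The reverse inequality is [le] again, for the factor [c^-1] and the family [c * f]. *)
have := @le c^-1 (fun i => c * f i); rewrite invr_gt0 => /(_ c0).
under eq_fun do rewrite mulKf ?gt_eqF//.
by rewrite muleC; apply => i; rewrite mulr_ge0// ltW.
Qed.

Lemma nnsum_reindex f (s t : I -> I) : cancel s t -> cancel t s ->
  nnsum (fun i => f (s i)) = nnsum f.
Proof.
move=> st ts; rewrite /nnsum.
rewrite [RHS](@reindex_esum _ _ _ setT setT s)//.
split => //; first by move=> i j _ _; exact: (can_inj st).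
by move=> i _; exists (t i).
Qed.

Lemma abs_summableW f g : (forall i, `|f i| <= g i) -> (nnsum g < +oo)%E ->
  abs_summable f.
Proof. by move=> fg; apply: le_lt_trans; exact: le_nnsum. Qed.

Lemma abs_summableD f g : abs_summable f -> abs_summable g ->
  abs_summable (fun i => f i + g i).
Proof.
move=> sf sg; apply: (@abs_summableW _ (fun i => `|f i| + `|g i|)).
  by move=> i; exact: ler_normD.
by rewrite nnsumD// lte_add_pinfty.
Qed.

Lemma abs_summableZ c f : abs_summable f -> abs_summable (fun i => c * f i).
Proof.
move=> sf; apply: (@abs_summableW _ (fun i => `|c| * `|f i|)).
  by move=> i; rewrite normrM.
by rewrite nnsumZ// lte_mul_pinfty// ?lee_fin.
Qed.

(** Makes the second sum in [rsum] finite, by the bound [|f| - f <= 2 * |f|]. *)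
Lemma abs_summable_sub f : abs_summable f ->
  (nnsum (fun i => (`|f i| - f i)%R) < +oo)%E.
Proof.
move=> sf; apply: (@le_lt_trans _ _ (nnsum (fun i => 2 * `|f i|))).
  by apply: le_nnsum => i; have := ler_norm (- f i); rewrite normrN; lra.
by rewrite nnsumZ// lte_mul_pinfty// ?lee_fin.
Qed.

Let subnorm_ge0 f i : 0 <= `|f i| - f i.
Proof. by rewrite subr_ge0 ler_norm. Qed.

(** The value of [rsum] does not depend on how [f] is split into a difference of nonnegative
    summable families: both sides of [|f| + h = (|f| - f) + g] are sums of nonnegative families, to
    which [nnsumD] applies. Linearity of [rsum] follows by choosing convenient splittings. *)
Lemma rsumB f g h : (forall i, 0 <= g i) -> (forall i, 0 <= h i) ->
  (nnsum g < +oo)%E -> (nnsum h < +oo)%E -> (forall i, f i = g i - h i) ->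
  rsum f = fine (nnsum g) - fine (nnsum h).
Proof.
move=> g0 h0 sg sh fE.
have sf : abs_summable f.
  apply: (@abs_summableW _ (fun i => g i + h i)).
    by move=> i; rewrite fE; apply: (le_trans (ler_normB _ _)); rewrite !ger0_norm.
  by rewrite nnsumD// lte_add_pinfty.
have : nnsum (fun i => `|f i| + h i) = nnsum (fun i => (`|f i| - f i) + g i).
  by apply: eq_esum => i _; rewrite fE; congr EFin; ring.
have nf0 := @subnorm_ge0 f; have sf' := abs_summable_sub sf.
rewrite nnsumD// (nnsumD nf0 g0) => /(congr1 fine).
rewrite !fineD; do ?by apply: nnsum_fin_num.
by rewrite /rsum; lra.
Qed.

Lemma rsum_ge0 f : (forall i, 0 <= f i) -> (nnsum f < +oo)%E ->
  rsum f = fine (nnsum f).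
Proof.
move=> f0 sf; have z0 : nnsum (fun=> 0 : R) = 0%E by exact: esum1.
rewrite (@rsumB f f (fun=> 0)) ?z0 ?subr0//.
by move=> i; rewrite subr0.
Qed.

Lemma rsumD f g : abs_summable f -> abs_summable g ->
  rsum (fun i => f i + g i) = rsum f + rsum g.
Proof.
move=> sf sg.
have sf' := abs_summable_sub sf; have sg' := abs_summable_sub sg.
have nf0 := @subnorm_ge0 f; have ng0 := @subnorm_ge0 g.
rewrite (@rsumB _ (fun i => `|f i| + `|g i|)
  (fun i => (`|f i| - f i) + (`|g i| - g i))).
- rewrite nnsumD// (nnsumD nf0 ng0) !fineD; do ?by apply: nnsum_fin_num.
  by rewrite /rsum; lra.
- by move=> i; rewrite addr_ge0.
- by move=> i; rewrite addr_ge0.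
- by rewrite nnsumD// lte_add_pinfty.
- by rewrite (nnsumD nf0 ng0) lte_add_pinfty.
- by move=> i; ring.
Qed.

Lemma rsumN f : abs_summable f -> rsum (fun i => - f i) = - rsum f.
Proof.
move=> sf; have sf' := abs_summable_sub sf; have nf0 := @subnorm_ge0 f.
rewrite (@rsumB _ (fun i => `|f i| - f i) (fun i => `|f i|))//.
  by rewrite /rsum opprB.
by move=> i; ring.
Qed.

Lemma rsumZ c f : abs_summable f -> rsum (fun i => c * f i) = c * rsum f.
Proof.
wlog c0 : c / 0 <= c.
  move=> H sf; have [c0|c0] := leP 0 c; first exact: H.
  have := H (- c); rewrite oppr_ge0 => /(_ (ltW c0) sf).
  under eq_fun do rewrite mulNr.
  by rewrite rsumN ?mulNr; [move/oppr_inj|exact: abs_summableZ].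
move=> sf; have sf' := abs_summable_sub sf; have nf0 := @subnorm_ge0 f.
rewrite (@rsumB _ (fun i => c * `|f i|) (fun i => c * (`|f i| - f i))).
- by rewrite !nnsumZ// !fineM//; [rewrite /rsum mulrBr|exact: nnsum_fin_num..].
- by move=> i; rewrite mulr_ge0.
- by move=> i; rewrite mulr_ge0.
- by rewrite nnsumZ// lte_mul_pinfty// ?lee_fin.
- by rewrite nnsumZ// lte_mul_pinfty// ?lee_fin.
- by move=> i; ring.
Qed.

Lemma rsum_reindex f (s t : I -> I) : cancel s t -> cancel t s ->
  rsum (fun i => f (s i)) = rsum f.
Proof.
by move=> st ts; rewrite /rsum (nnsum_reindex (fun i => `|f i|) st ts)
  (nnsum_reindex (fun i => `|f i| - f i) st ts).
Qed.

End RealSum.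

(** * The squared modulus of a complex number, as a real number *)

Section Complex.
Variable R : realType.
Implicit Types (x y z : R[i]) (t : R).

Definition sqmod z : R := Re z ^+ 2 + Im z ^+ 2.

Lemma sqmodE z : (sqmod z)%:C = `|z| ^+ 2.
Proof. exact: add_Re2_Im2. Qed.

Lemma ReB x y : Re (x - y) = Re x - Re y.
Proof. by case: x y => [? ?] []. Qed.

Lemma ImB x y : Im (x - y) = Im x - Im y.
Proof. by case: x y => [? ?] []. Qed.

Lemma conjcM x y : (x * y)^* = x^* * y^*.
Proof. exact: rmorphM. Qed.

Lemma posC_real z : 0 < z -> z = (Re z)%:C.
Proof. by case: z => a b; rewrite ltcE /= => /andP[/eqP->]. Qed.

Lemma sqmod_ge0 z : 0 <= sqmod z.
Proof. by rewrite addr_ge0// sqr_ge0. Qed.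

Lemma sqmodM x y : sqmod (x * y) = sqmod x * sqmod y.
Proof. by case: x y => [a b] [c d]; rewrite /sqmod /=; ring. Qed.

Lemma sqmod_eq0 z : sqmod z = 0 -> z = 0.
Proof.
case: z => a b /eqP; rewrite paddr_eq0 ?sqr_ge0// !sqrf_eq0 /=.
by move=> /andP[/eqP-> /eqP->].
Qed.

(* Choosing t = |y| / |x| makes the right-hand side (|x| + |y|)^2; used with l^2
   norms, this gives Minkowski's inequality without Cauchy-Schwarz. *)
Lemma sqmodD_le t x y : 0 < t ->
  sqmod (x + y) <= (1 + t) * sqmod x + (1 + t^-1) * sqmod y.
Proof.
move=> t0; have tV : t^-1 * t = 1 by rewrite mulVf// gt_eqF.
suff H a b : (a + b) ^+ 2 <= (1 + t) * a ^+ 2 + (1 + t^-1) * b ^+ 2.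
  case: x y => [a b] [c d]; rewrite /sqmod /=.
  by have := H a c; have := H b d; lra.
have : 0 <= t^-1 * (t * a - b) ^+ 2 by rewrite mulr_ge0 ?sqr_ge0// invr_ge0 ltW.
have -> : t^-1 * (t * a - b) ^+ 2 =
    (t^-1 * t) * t * a ^+ 2 - (t^-1 * t) * (a * b) *+ 2 + t^-1 * b ^+ 2 by ring.
by rewrite tV; lra.
Qed.

Lemma mulcJ_sqmod z : z * z^* = (sqmod z)%:C.
Proof. by rewrite sqmodE sqr_normc. Qed.

Lemma sqmodJ z : sqmod z^* = sqmod z.
Proof. by case: z => a b; rewrite /sqmod /= sqrrN. Qed.

Lemma sqmodX z n : sqmod z = 1 -> sqmod (z ^+ n) = 1.
Proof.
move=> z1; elim: n => [|n IHn]; last by rewrite exprS sqmodM z1 IHn mulr1.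
by rewrite expr0 /sqmod /= expr1n expr0n addr0.
Qed.

End Complex.

(** * Complex sums, taken separately on real and imaginary parts *)

Section ComplexSum.
Variables (R : realType) (I : choiceType).
Implicit Types (f g : I -> R[i]) (c : R[i]).

Definition csummable f : Prop :=
  abs_summable (fun i => Re (f i)) /\ abs_summable (fun i => Im (f i)).

Definition csum f : R[i] :=
  rsum (fun i => Re (f i)) +i* rsum (fun i => Im (f i)).

Lemma csumP c f g : csummable f -> csummable g ->
  csum (fun i => c * f i + g i) = c * csum f + csum g.
Proof.
move=> [Rf If] [Rg Ig]; rewrite /csum; case: c => a b.
have re i : Re ((a +i* b) * f i + g i) =
    a * Re (f i) + ((- b) * Im (f i) + Re (g i)).
  by case: (f i) (g i) => [? ?] [? ?] /=; ring.
have im i : Im ((a +i* b) * f i + g i) =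
    a * Im (f i) + (b * Re (f i) + Im (g i)).
  by case: (f i) (g i) => [? ?] [? ?] /=; ring.
under [X in rsum X +i* _]eq_fun do rewrite re.
under [X in _ +i* rsum X]eq_fun do rewrite im.
have Rf' := abs_summableZ a Rf; have Rf'' := abs_summableZ b Rf.
have If' := abs_summableZ a If; have If'' := abs_summableZ (- b) If.
rewrite !rsumD ?rsumZ//; do ?exact: abs_summableD.
by apply/eqP; rewrite eq_complex /=; apply/andP; split; apply/eqP; ring.
Qed.

Lemma csum_conj f : csummable f -> csum (fun i => (f i)^*) = (csum f)^*.
Proof.
move=> [Rf If]; rewrite /csum /= -rsumN//.
by congr Complex; congr rsum; apply/funext => i; case: (f i).
Qed.

Lemma csum_reindex f (s t : I -> I) : cancel s t -> cancel t s ->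
  csum (fun i => f (s i)) = csum f.
Proof.
by move=> st ts; rewrite /csum (rsum_reindex (fun i => Re (f i)) st ts)
  (rsum_reindex (fun i => Im (f i)) st ts).
Qed.

End ComplexSum.

(** * Square-summable families form a vector space *)

Section SquareSummable.
Variables (R : realType) (I : choiceType).
Implicit Types (f g : I -> R[i]) (c : R[i]).

Definition nnsum_sqmod f : \bar R := nnsum (fun i => sqmod (f i)).

(** The codomain [R[i]^o] is [R[i]] seen as a module over itself, which gives the function space its
    [R[i]]-module structure. *)
Definition square_summable : pred (I -> R[i]^o) :=
  fun f => (nnsum_sqmod f < +oo)%E.

Lemma nnsum_sqmodD_le t f g : 0 < t -> (nnsum_sqmod (fun i => (f i + g i)%R) <=
  (1 + t)%:E * nnsum_sqmod f + (1 + t^-1)%:E * nnsum_sqmod g)%E.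
Proof.
move=> t0; have t1 : 0 <= 1 + t by lra.
have t2 : 0 <= 1 + t^-1 by rewrite addr_ge0// invr_ge0 ltW.
have f0 i := sqmod_ge0 (f i); have g0 i := sqmod_ge0 (g i).
rewrite -!nnsumZ// -nnsumD.
- by apply: le_nnsum => i; exact: sqmodD_le.
- by move=> i; rewrite mulr_ge0.
- by move=> i; rewrite mulr_ge0.
Qed.

Lemma nnsum_sqmodZ c f :
  nnsum_sqmod (fun i => c * f i) = ((sqmod c)%:E * nnsum_sqmod f)%E.
Proof.
rewrite -nnsumZ ?sqmod_ge0//; last by move=> i; exact: sqmod_ge0.
by apply: eq_esum => i _; rewrite sqmodM.
Qed.

Lemma square_summable_submod : GRing.submod_closed square_summable.
Proof.
rewrite /square_summable; split => [|c f g]; rewrite !unfold_in.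
  rewrite /nnsum_sqmod /nnsum esum1 ?ltry// => i _.
  by rewrite /sqmod /= expr0n addr0.
(* Only finiteness matters, so any positive [t] would serve; [t = 1] is taken. *)
move=> sf sg; apply: (le_lt_trans (@nnsum_sqmodD_le 1 (fun i => c * f i) g _)).
  by [].
rewrite nnsum_sqmodZ lte_add_pinfty// !lte_mul_pinfty ?lee_fin ?sqmod_ge0//.
Qed.

HB.instance Definition _ :=
  GRing.isSubmodClosed.Build R[i] (I -> R[i]^o) square_summable
    square_summable_submod.

Record ell2 := Ell2 {
  ell2_fun :> I -> R[i]^o;
  ell2_square_summable : ell2_fun \in square_summable
}.

HB.instance Definition _ := [isSub for ell2_fun].
HB.instance Definition _ := [Choice of ell2 by <:].
HB.instance Definition _ := [SubChoice_isSubLmodule of ell2 by <:].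

End SquareSummable.

(** * The norm of l^2 *)

Section Ell2Norm.
Variables (R : realType) (I : choiceType).
Implicit Types (x y : ell2 R I) (c : R[i]).

Definition ell2_sqnorm x : R := fine (nnsum_sqmod x).

Lemma ell2_fin_num x : nnsum_sqmod x \is a fin_num.
Proof.
apply: nnsum_fin_num => [i|]; first exact: sqmod_ge0.
exact: ell2_square_summable.
Qed.

Lemma ell2_sqnorm_ge0 x : 0 <= ell2_sqnorm x.
Proof. by apply/fine_ge0/nnsum_ge0 => i; exact: sqmod_ge0. Qed.

Lemma ell2_sqnormZ c x : ell2_sqnorm (c *: x) = sqmod c * ell2_sqnorm x.
Proof.
rewrite /ell2_sqnorm; have := nnsum_sqmodZ c x.
by move=> /(congr1 fine); rewrite fineM// ell2_fin_num.
Qed.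

Lemma ell2_sqnorm_coord x i : sqmod (x i) <= ell2_sqnorm x.
Proof.
rewrite -lee_fin fineK ?ell2_fin_num//; apply: esum_ge.
by exists [set i]; [split|rewrite fsbig_set1].
Qed.

Lemma ell2_sqnorm_eq0 x : ell2_sqnorm x = 0 -> x = 0.
Proof.
move=> x0; apply/val_inj/funext => i /=; apply: sqmod_eq0; apply/eqP.
by rewrite eq_le sqmod_ge0 -x0 ell2_sqnorm_coord.
Qed.

Lemma ell2_sqnormD_le t x y : 0 < t ->
  ell2_sqnorm (x + y) <= (1 + t) * ell2_sqnorm x + (1 + t^-1) * ell2_sqnorm y.
Proof.
move=> t0; rewrite -lee_fin EFinD !EFinM !fineK ?ell2_fin_num//.
exact: nnsum_sqmodD_le.
Qed.

Definition ell2_norm x : R[i] := (Num.sqrt (ell2_sqnorm x))%:C.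

Lemma ell2_norm_eq0 x : ell2_norm x = 0 -> x = 0.
Proof.
move=> /complexI/eqP; rewrite sqrtr_eq0 => x0.
by apply/ell2_sqnorm_eq0/eqP; rewrite eq_le x0 ell2_sqnorm_ge0.
Qed.

Lemma ell2_normZ c x : ell2_norm (c *: x) = `|c| * ell2_norm x.
Proof.
by rewrite /ell2_norm ell2_sqnormZ sqrtrM ?sqmod_ge0// rmorphM normc_def.
Qed.

Lemma ler_ell2_normD x y : ell2_norm (x + y) <= ell2_norm x + ell2_norm y.
Proof.
rewrite /ell2_norm -rmorphD lecR.
(* With a and b the norms of [x] and [y], the weight will be t = b / a, for which (1 + t) a^2 + (1 +
   1/t) b^2 = (a + b)^2. This requires a and b to be positive, so zero vectors are treated apart. *)
have [->|x0] := eqVneq x 0; first by rewrite add0r lerDr sqrtr_ge0.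
have [->|y0] := eqVneq y 0; first by rewrite addr0 lerDl sqrtr_ge0.
have gt0 z : z != 0 -> 0 < Num.sqrt (ell2_sqnorm z).
  move=> z0; rewrite sqrtr_gt0 lt_def ell2_sqnorm_ge0 andbT.
  by apply: contra_neq z0; exact: ell2_sqnorm_eq0.
have := gt0 _ x0; have := gt0 _ y0.
set a := Num.sqrt (ell2_sqnorm x); set b := Num.sqrt (ell2_sqnorm y) => b0 a0.
have -> : a + b = Num.sqrt ((a + b) ^+ 2).
  by rewrite sqrtr_sqr ger0_norm// addr_ge0 ?ltW.
apply: ler_wsqrtr; apply: le_trans (ell2_sqnormD_le x y (divr_gt0 b0 a0)) _.
rewrite -(sqr_sqrtr (ell2_sqnorm_ge0 x)) -(sqr_sqrtr (ell2_sqnorm_ge0 y)).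
rewrite -/a -/b le_eqVlt; apply/orP; left; apply/eqP; field.
by rewrite !gt_eqF.
Qed.

HB.instance Definition _ := Lmodule_isNormed.Build R[i] (ell2 R I)
  ler_ell2_normD ell2_normZ ell2_norm_eq0.

Lemma ell2_normE x : `|x| = (Num.sqrt (ell2_sqnorm x))%:C.
Proof. by []. Qed.

Lemma ell2_sqnorm_le (e : R) x : 0 <= e -> `|x| < e%:C -> ell2_sqnorm x <= e ^+ 2.
Proof.
move=> e0; rewrite ell2_normE ltcR => /ltW le_e.
rewrite -(sqr_sqrtr (ell2_sqnorm_ge0 x)).
by rewrite lerXn2r// nnegrE sqrtr_ge0.
Qed.

End Ell2Norm.

(** * Completeness of l^2 *)

Section Ell2Complete.
Variables (R : realType) (I : choiceType).
Implicit Types (x y : ell2 R I).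

(** The limit is built coordinatewise. Bounds on finite partial sums pass to the coordinatewise
    limit, and the supremum over finite sets turns them into bounds on the l^2 norm. *)
Lemma ell2_complete (F : set_system (ell2 R I)) :
  ProperFilter F -> cauchy F -> cvg F.
Proof.
move=> FF /cauchyP Fcauchy.
(* A 1-Lipschitz real function carries [F] to a Cauchy filter, which converges since the reals are
   complete. *)
have coord (rho : ell2 R I -> R) :
    (forall x y, `|rho x - rho y|%:C <= `|x - y|) -> cvg (rho @ F).
  move=> rho_lip; apply/cauchy_cvgP/cauchyP => e e0.
  have [|x0 Fx0] := Fcauchy e%:C; first by rewrite ltcR.
  exists (rho x0); suff : F (rho @^-1` ball (rho x0) e) by [].
  apply: filterS Fx0 => y /=; rewrite -!ball_normE /= => x0y.
  by rewrite -ltcR; apply: le_lt_trans x0y.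
have cvRe i : cvg ((fun x : ell2 R I => Re (x i)) @ F).
  apply: coord => x y; rewrite ell2_normE lecR -sqrtr_sqr ler_wsqrtr//.
  apply: le_trans (ell2_sqnorm_coord (x - y) i).
  by rewrite -ReB /sqmod lerDl sqr_ge0.
have cvIm i : cvg ((fun x : ell2 R I => Im (x i)) @ F).
  apply: coord => x y; rewrite ell2_normE lecR -sqrtr_sqr ler_wsqrtr//.
  apply: le_trans (ell2_sqnorm_coord (x - y) i).
  by rewrite -ImB /sqmod lerDr sqr_ge0.
pose g i : R[i]^o := lim ((fun x : ell2 R I => Re (x i)) @ F) +i*
                     lim ((fun x : ell2 R I => Im (x i)) @ F).
have sq (u : R) (rho : ell2 R I -> R) : cvg (rho @ F) ->
    (u - rho y) ^+ 2 @[y --> F] --> (u - lim (rho @ F)) ^+ 2.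
  move=> cvrho; rewrite expr2; under eq_cvg do rewrite expr2.
  by apply: cvgM; (apply: cvgB; [exact: cvg_cst|exact: cvrho]).
have cv_sqmod (u : R[i]) i :
    sqmod (u - y i) @[y --> F] --> sqmod (u - g i).
  rewrite /sqmod ReB ImB; under eq_cvg do rewrite ReB ImB.
  by apply: cvgD; apply: sq.
have cv_sum (x0 : ell2 R I) (s : seq I) :
    \sum_(i <- s) sqmod (x0 i - y i) @[y --> F] -->
    \sum_(i <- s) sqmod (x0 i - g i).
  elim: s => [|i s IHs].
    by rewrite big_nil; under eq_cvg do rewrite big_nil; exact: cvg_cst.
  by rewrite big_cons; under eq_cvg do rewrite big_cons; exact: cvgD.
(* For [y] in the ball around [x0], every finite partial sum of [|x0 - y|^2] is at most [e ^+ 2];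
   letting [y] follow [F] replaces [y] by [g]. *)
have close (e : R) x0 : 0 < e -> F (ball x0 e%:C) ->
    (nnsum_sqmod (fun i => x0 i - g i)%R <= (e ^+ 2)%:E)%E.
  move=> e0 Fx0; apply: ge_ereal_sup => _ [A [finA _] <-].
  rewrite fsumEFin// lee_fin.
  apply: (@cvgr_to_le _ F _ _ (fun y => \sum_(i \in A) sqmod (x0 i - y i))).
    rewrite fsbig_finite//; under eq_cvg do rewrite fsbig_finite//.
    exact: cv_sum.
  apply: filterS Fx0 => y; rewrite -ball_normE /= => x0y.
  have := ell2_sqnorm_le (ltW e0) x0y; apply: le_trans.
  rewrite -lee_fin fineK ?ell2_fin_num// -fsumEFin//.
  by apply: ereal_sup_ubound; exists A.
(* One ball of radius 1 shows that [x0 - g] lies in l^2; hence so does [g], recovered as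
   [x0 - d]. *)
have [|x0 Fx0] := Fcauchy 1; first by [].
have /(le_lt_trans (close 1 x0 ltr01 Fx0)) dl2 : ((1 ^+ 2)%:E < +oo :> \bar R)%E.
  by rewrite ltry.
pose d : ell2 R I :=
  Ell2 (dl2 : (fun i => x0 i - g i : R[i]^o) \in @square_summable R I).
apply/cvg_ex; exists (x0 - d); apply/cvg_ballP => e e0.
have gE i : (x0 - d) i = g i by exact: subKr.
(* The radius [e] lives in [R[i]], but being positive it is real and can be halved in [R]. *)
have [e' [e'0 eE]] : exists e' : R, 0 < e' /\ e = (2 * e')%:C.
  exists (Re e / 2); rewrite mulrCA divff// mulr1 -posC_real//; split=> //.
  by rewrite divr_gt0//; move: e0; rewrite ltcE => /andP[].
have [|x1 Fx1] := Fcauchy e'%:C; first by rewrite ltcR.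
have x1g : `|x1 - (x0 - d)| <= e'%:C.
  rewrite ell2_normE lecR -(ger0_norm (ltW e'0)) -sqrtr_sqr ler_wsqrtr//.
  rewrite -lee_fin fineK ?ell2_fin_num//; apply: le_trans (close _ _ e'0 Fx1).
  by apply: le_nnsum => i; rewrite -gE.
apply: filterS Fx1 => y; rewrite -!ball_normE /= => x1y.
rewrite -(subrK x1 (x0 - d)) -addrA (le_lt_trans (ler_normD _ _))//.
by rewrite eE mulr_natl mulr2n rmorphD ler_ltD// distrC.
Qed.

HB.instance Definition _ := Uniform_isComplete.Build (ell2 R I) ell2_complete.

End Ell2Complete.

(** * The inner product of l^2 *)

Section Ell2Inner.
Variables (R : realType) (I : choiceType).
Implicit Types (x y z : ell2 R I) (c : R[i]).

Definition ell2_inner x y : R[i] := csum (fun i => x i * (y i)^*).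

Lemma csummable_mulJ x y : csummable (fun i => x i * (y i)^*).
Proof.
have sxy : (nnsum (fun i => (sqmod (x i) + sqmod (y i))%R) < +oo)%E.
  rewrite nnsumD => [|i|i]; try exact: sqmod_ge0.
  apply: lte_add_pinfty; exact: ell2_square_summable.
(* For x = a + ib and y = c + id the parts of x times the conjugate of y are ac + bd and bc - ad.
   Each bound by a^2 + b^2 + c^2 + d^2 comes from the squares that produce these products with the
   right sign. *)
split; apply: abs_summableW sxy => i; case: (x i) (y i) => [a b] [c d];
  rewrite /sqmod /= ler_norml; apply/andP; split.
- have := sqr_ge0 (a + c); have := sqr_ge0 (b + d).
  have := sqr_ge0 a; have := sqr_ge0 b; have := sqr_ge0 c; have := sqr_ge0 d.
  by lra.
- have := sqr_ge0 (a - c); have := sqr_ge0 (b - d).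
  have := sqr_ge0 a; have := sqr_ge0 b; have := sqr_ge0 c; have := sqr_ge0 d.
  by lra.
- have := sqr_ge0 (a - d); have := sqr_ge0 (b + c).
  have := sqr_ge0 a; have := sqr_ge0 b; have := sqr_ge0 c; have := sqr_ge0 d.
  by lra.
- have := sqr_ge0 (a + d); have := sqr_ge0 (b - c).
  have := sqr_ge0 a; have := sqr_ge0 b; have := sqr_ge0 c; have := sqr_ge0 d.
  by lra.
Qed.

Lemma ell2_innerPl z c x y :
  ell2_inner (c *: x + y) z = c * ell2_inner x z + ell2_inner y z.
Proof.
rewrite /ell2_inner -csumP; try exact: csummable_mulJ.
by congr csum; apply/funext => i; rewrite mulrA -mulrDl.
Qed.

Lemma ell2_innerC x y : ell2_inner x y = (ell2_inner y x)^*.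
Proof.
rewrite /ell2_inner -csum_conj; last exact: csummable_mulJ.
by congr csum; apply/funext => i; rewrite conjcM conjcK mulrC.
Qed.

Lemma ell2_innerPr z c x y :
  ell2_inner z (c *: x + y) = c^* * ell2_inner z x + ell2_inner z y.
Proof.
rewrite ell2_innerC ell2_innerPl (ell2_innerC z x) (ell2_innerC z y).
by rewrite rmorphD rmorphM.
Qed.

Lemma ell2_inner_sqnorm x : ell2_inner x x = (ell2_sqnorm x)%:C.
Proof.
rewrite /ell2_inner /csum /ell2_sqnorm -rsum_ge0.
- apply/eqP; rewrite eq_complex /=; apply/andP; split; apply/eqP.
    by congr rsum; apply/funext => i; rewrite /sqmod; case: (x i) => a b /=; ring.
  rewrite rsum_ge0.
  - by rewrite /nnsum esum1// => i _; case: (x i) => a b /=; congr EFin; ring.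
  - by move=> i; case: (x i) => a b /=; rewrite mulrN mulrC addrC subrr.
  - by rewrite /nnsum esum1// => i _; case: (x i) => a b /=; congr EFin; ring.
- by move=> i; exact: sqmod_ge0.
- exact: ell2_square_summable.
Qed.

HB.instance Definition _ := @bilinear_isBilinear.Build R[i] (ell2 R I) (ell2 R I)
  R[i] *%R (@Num.conj R[i] \; *%R) ell2_inner (ell2_innerPl, ell2_innerPr).

(** The boolean exponent encodes the sign of the form: [false] selects Hermitian rather than
    skew-Hermitian. *)
Lemma ell2_inner_hermitian x y :
  ell2_inner x y = (-1) ^+ false * Num.conj (ell2_inner y x).
Proof. by rewrite expr0 mul1r; exact: ell2_innerC. Qed.

HB.instance Definition _ := @isHermitianSesquilinear.Build R[i] (ell2 R I)
  false (@Num.conj R[i]) ell2_inner ell2_inner_hermitian.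

Lemma ell2_inner_gt0 x : x != 0 -> 0 < ell2_inner x x.
Proof.
move=> x0; rewrite ell2_inner_sqnorm ltcR lt_def ell2_sqnorm_ge0 andbT.
by apply: contra_neq x0; exact: ell2_sqnorm_eq0.
Qed.

HB.instance Definition _ := @isDotProduct.Build R[i] (ell2 R I)
  ell2_inner ell2_inner_gt0.

Lemma ell2_sqr_norm x : `|x| ^+ 2 = ell2_inner x x.
Proof.
by rewrite ell2_normE -rmorphXn /= sqr_sqrtr ?ell2_sqnorm_ge0 ?ell2_inner_sqnorm.
Qed.

HB.instance Definition _ :=
  @CompleteNormedModule_isHilbert.Build R (ell2 R I) ell2_inner ell2_sqr_norm.

Lemma ell2_nontrivial (i0 : I) : exists x, x != 0.
Proof.
(* The basis vector concentrated at [i0]. *)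
pose f : I -> R[i]^o := fun i => (i == i0)%:R.
have fl2 : f \in @square_summable R I.
  rewrite unfold_in; apply: (@le_lt_trans _ _ (\esum_(i in [set i0]) 1%:E)%E).
    rewrite [leRHS]esum_mkcond; apply: le_esum => i _.
    rewrite /f /sqmod; have [->|/eqP ii0] := eqVneq i i0.
      by rewrite mem_set//= expr1n expr0n addr0.
    by rewrite memNset//= expr0n addr0.
  by rewrite esum_set1// ltry.
exists (Ell2 fl2); apply/eqP => /(congr1 (fun x : ell2 R I => x i0)) /= /eqP.
by rewrite /f eqxx oner_eq0.
Qed.

End Ell2Inner.

(** * Permutations of coordinates with unimodular weights *)

Section WeightedPermutation.
Variables (R : realType) (I : choiceType).
Implicit Types (w : I -> R[i]) (s t : I -> I) (x y : ell2 R I).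

Lemma weighted_perm_square_summable w s t x : (forall i, sqmod (w i) = 1) ->
  cancel s t -> cancel t s ->
  (fun i => w i * x (s i) : R[i]^o) \in @square_summable R I.
Proof.
move=> w1 st ts; rewrite unfold_in /nnsum_sqmod.
under eq_fun do rewrite sqmodM w1 mul1r.
rewrite (nnsum_reindex (fun i => sqmod (x i)) st ts).
exact: ell2_square_summable.
Qed.

Variables (w : I -> R[i]) (s t : I -> I).
Hypotheses (w1 : forall i, sqmod (w i) = 1) (st : cancel s t) (ts : cancel t s).

Definition weighted_perm x : ell2 R I :=
  Ell2 (weighted_perm_square_summable x w1 st ts).

Lemma weighted_perm_linear : linear weighted_perm.
Proof.
by move=> c x y; apply/val_inj/funext => i /=; rewrite mulrDr mulrCA.
Qed.

HB.instance Definition _ :=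
  GRing.isLinear.Build R[i] (ell2 R I) (ell2 R I) _ weighted_perm
    weighted_perm_linear.

Lemma weighted_perm_norm x : `|weighted_perm x| = `|x|.
Proof.
rewrite !ell2_normE /ell2_sqnorm /nnsum_sqmod /=.
under eq_fun do rewrite sqmodM w1 mul1r.
by rewrite (nnsum_reindex (fun i => sqmod (x i)) st ts).
Qed.

Lemma weighted_perm_bounded :
  bounded_operator (weighted_perm : {linear ell2 R I -> ell2 R I}).
Proof. by exists 1 => x; rewrite weighted_perm_norm mul1r. Qed.

End WeightedPermutation.

(** Adjoint and inverse are the same operator: the permutation along [t] with weights [(w (t i))^*].
    Adjointness is a reindexing of the sum along [s], and invertibility is [w i * (w i)^* = 1]. *)
Lemma weighted_perm_unitary (R : realType) (I : choiceType) (w : I -> R[i])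
    (s t : I -> I) (w1 : forall i, sqmod (w i) = 1) (st : cancel s t)
    (ts : cancel t s) :
  unitary_operator (weighted_perm w1 st ts : {linear ell2 R I -> ell2 R I}).
Proof.
split; first exact: weighted_perm_bounded.
have w'1 i : sqmod (w (t i))^* = 1 by rewrite sqmodJ.
have wwJ i : w i * (w i)^* = 1 by rewrite mulcJ_sqmod w1.
exists (weighted_perm w'1 ts st : {linear ell2 R I -> ell2 R I}); split.
- exact: weighted_perm_bounded.
- move=> x y; rewrite /inner /= /ell2_inner -[RHS](csum_reindex _ st ts).
  congr csum; apply/funext => i.
  by rewrite /= st conjcM conjcK mulrCA mulrA.
- move=> x; apply/val_inj/funext => i /=.
  by rewrite ts mulrA mulrC [_^* * _]mulrC wwJ mulr1.
- move=> x; apply/val_inj/funext => i /=.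
  by rewrite st mulrA wwJ mul1r.
Qed.

(** * The root of unity *)

Section Zeta.
Variable R : realType.

(** De Moivre's formula, by induction from the addition formulas. *)
Lemma cis_expr (t : R) n :
  (cos t +i* sin t) ^+ n = cos (n%:R * t) +i* sin (n%:R * t).
Proof.
elim: n => [|n IHn]; first by rewrite expr0 mul0r cos0 sin0.
rewrite exprS IHn -natr1 mulrDl mul1r addrC cosD sinD.
by apply/eqP; rewrite eq_complex /=; apply/andP; split; apply/eqP; ring.
Qed.

Lemma zetaE p : zeta R p = cos (2 * pi / p%:R) +i* sin (2 * pi / p%:R).
Proof. by rewrite /zeta /expC expR0 mul1r. Qed.

Lemma zeta_exprn p : (0 < p)%N -> zeta R p ^+ p = 1.
Proof.
move=> p0; rewrite zetaE cis_expr mulrC divfK ?pnatr_eq0 -?lt0n//.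
by rewrite mulrC mulr_natr cos2pi sin2pi.
Qed.

Lemma sqmod_zeta p : sqmod (zeta R p) = 1.
Proof. by rewrite zetaE /sqmod /= cos2Dsin2. Qed.

End Zeta.

(** * The twisted shifts and their relations *)

Section TwistedShifts.
Variables (R : realType) (p : nat) (p_prime : prime p).
Variables (c : nat -> nat -> 'F_p).
Implicit Types (v : nat -> 'F_p) (j k n : nat).

(** Exponents are the natural representatives of elements of ['F_p], so the sum on the left is
    reduced mod [p]; this is harmless since [zeta] has [p]-th power 1. *)
Lemma zeta_exprD (a b : 'F_p) :
  zeta R p ^+ (a + b)%R = zeta R p ^+ a * zeta R p ^+ b.
Proof.
rewrite -exprD -(expr_mod (_ + _) (zeta_exprn R (prime_gt0 p_prime))).
(* Addition in ['F_p] reduces modulo [(Zp_trunc (pdiv p)).+2], which is [p] because [p] is prime. *)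
by congr (_ ^+ (_ %% _)%N); exact: Fp_cast.
Qed.

Definition shift_site k v : nat -> 'F_p := fun i => v i + (i == k)%:R.

Definition unshift_site k v : nat -> 'F_p := fun i => v i - (i == k)%:R.

Lemma shift_siteK k : cancel (shift_site k) (unshift_site k).
Proof. by move=> v; apply/funext => i; exact: addrK. Qed.

Lemma unshift_siteK k : cancel (unshift_site k) (shift_site k).
Proof. by move=> v; apply/funext => i; exact: subrK. Qed.

Lemma iter_shift_site k : iter p (shift_site k) =1 id.
Proof.
move=> v; apply/funext => i.
have -> n : iter n (shift_site k) v i = v i + (i == k)%:R *+ n.
  by elim: n => [|n IHn]; rewrite ?addr0// iterS {1}/shift_site IHn mulrSr addrA.
by rewrite -mulr_natr (pcharf0 (pchar_Fp p_prime)) mulr0 addr0.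
Qed.

Definition phase k v : 'F_p := \sum_(j < k) c j k * v j.

(** [phase j] is linear in [v], and coordinate [k] enters it only when [k < j], with coefficient
    [c k j]. *)
Lemma phase_shift j k v :
  phase j (shift_site k v) = phase j v + (if (k < j)%N then c k j else 0).
Proof.
rewrite /phase /shift_site; under eq_bigr do rewrite mulrDr.
rewrite big_split /=; congr (_ + _); case: ifPn => kj.
  rewrite (bigD1 (Ordinal kj))//= eqxx mulr1 big1 ?addr0// => i /negPf.
  by rewrite -val_eqE /= => ->; rewrite mulr0.
rewrite big1// => i _; rewrite (_ : (i : nat) == k = false) ?mulr0//.
by apply: contraNF kj => /eqP <-.
Qed.

Lemma sqmod_zeta_phase k v : sqmod (zeta R p ^+ phase k v) = 1.
Proof. exact/sqmodX/sqmod_zeta. Qed.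

Definition twisted_shift k : {linear ell2 R (nat -> 'F_p) -> ell2 R (nat -> 'F_p)} :=
  weighted_perm (sqmod_zeta_phase k) (shift_siteK k) (unshift_siteK k).

Lemma iter_twisted_shift k : iter p (twisted_shift k) =1 id.
Proof.
move=> x; apply/val_inj/funext => v /=.
(* The weight is constant along the orbits of [shift_site k], by [phase_shift] with [j = k], so
   iterating merely raises it to a power. *)
have iterE n u : iter n (twisted_shift k) x u =
    (zeta R p ^+ phase k u) ^+ n * x (iter n (shift_site k) u).
  elim: n u => [|n IHn] u; first by rewrite mul1r.
  rewrite iterS /= IHn phase_shift ltnn addr0 mulrA -exprS.
  by rewrite -iterSr.
by rewrite iterE iter_shift_site exprAC zeta_exprn ?prime_gt0// expr1n mul1r.
Qed.

Lemma twisted_shift_comm (c_skew : skew_symmetric_matrix c) j k x :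
  twisted_shift j (twisted_shift k x) =
  zeta R p ^+ (c j k) *: twisted_shift k (twisted_shift j x).
Proof.
apply/val_inj/funext => v.
transitivity (zeta R p ^+ c j k * (zeta R p ^+ phase k v *
  (zeta R p ^+ phase j (shift_site k v) * x (shift_site j (shift_site k v)))));
  last by [].
have -> : shift_site j (shift_site k v) = shift_site k (shift_site j v).
  by apply/funext => i; rewrite /shift_site addrAC.
(* The commutation relation read on exponents. For [j < k] the term [c j k] comes from [phase k];
   for [k < j] the term [c k j] from [phase j] cancels it; for [j = k] it vanishes by the zero
   diagonal. *)
have phaseC : phase j v + phase k (shift_site j v) =
    c j k + phase k v + phase j (shift_site k v).
  rewrite !phase_shift; have [cjk cjj] := c_skew j k.
  by case: ltngtP => [_|_|jk]; rewrite -?jk ?cjj ?cjk; ring.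
by rewrite /= !mulrA -!zeta_exprD phaseC.
Qed.

End TwistedShifts.

Theorem proposition1p1 (R : realType) (p : nat) (p_prime : prime p)
    (c : nat -> nat -> 'F_p) (c_skew : skew_symmetric_matrix c) :
  exists H : hilbertType R,
    (exists x : H, x != 0) /\
    exists U : nat -> {linear H -> H},
      [/\ forall k, unitary_operator (U k),
          forall k, iter p (U k) =1 id &
          forall j k x, U j (U k x) = zeta R p ^+ (c j k) *: U k (U j x)].
Proof.
exists (ell2 R (nat -> 'F_p)); split; first exact: (ell2_nontrivial R (fun=> 0)).
exists (twisted_shift R c); split=> [k|k|j k x].
- exact: weighted_perm_unitary.
- exact: iter_twisted_shift.
- exact: twisted_shift_comm.
Qed.
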